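(* Iterative approximate crash consensus can be achieved on a given directed graph $G(\mathcal V,\mathcal E)$ if and only if every reduced graph (under crash faults) of $G(\mathcal V,\mathcal E)$ contains a source component, i.e., if and only if $G(\mathcal V,\mathcal E)$ satisfies the following condition: every reduced graph (under crash faults) of $G(\mathcal V,\mathcal E)$ contains a unique non-trivial weakly-connected component, and the subgraph induced by this weakly-connected component contains a source.
   Context: A synchronous system of $n$ agents $\mathcal V=\{1,\dots,n\}$ communicates over a directed graph $G(\mathcal V,\mathcal E)$ without self-loops; agent $i$ can reliably transmit messages to agent $j$ if and only if $(i,j)\in\mathcal E$ (and each agent can use its own value). Up to $f$ of the agents may suffer crash faults, i.e., may unexpectedly stop participating in the algorithm. $\mathcal F$ denotes the set of faulty agents in a given execution; it may be chosen arbitrarily by an adversary, subject to $|\mathcal F|\le f$; $\mathcal N=\mathcal V-\mathcal F$. Iterative approximate crash consensus: each agent $i$ holds a real state with initial value $x_i[0]$. In each iteration $t\ge1$ the agents that have not crashed send their current states to their out-neighbours and update their states using only their own current state and the values received in that iteration (only local communication, minimal memory carried across iterations, no constraint set). It is achieved on $G$ if there is such an algorithm for which, despite up to $f$ crash faults, the states of non-faulty agents stay in the convex hull of the initial states and $\lim_{t\to\infty}|x_i[t]-x_j[t]|=0$ for all $i,j\in\mathcal N$. Reduced graph under crash faults: a subgraph of $G(\mathcal V,\mathcal E)$, with the same vertex set $\mathcal V$, obtained by removing all the edges incident to up to $|\mathcal F|$ nodes in $\mathcal F$. Source component (source) of a directed graph: the collection of its nodes each of which has a directed path to every other node of that graph;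 the graph contains a source if this collection is non-empty. A weakly-connected component is non-trivial if it has more than one node.
   Formalization: Literally false, so mended: the source is sought among nodes whose edges were not removed; the non-trivial weakly-connected component must contain all those nodes; f < n is assumed, and f + 2 ≤ n for the second equivalence. *)

(* Defs.v *)
(* MathComp / MathComp-Analysis. *)
From mathcomp Require Import all_boot all_order all_algebra.
From mathcomp Require Import all_classical all_reals all_analysis.
Import Order.TTheory GRing.Theory Num.Theory.
Import numFieldNormedType.Exports.

Set Implicit Arguments.
Unset Strict Implicit.
Unset Printing Implicit Defensive.

(** * Graphs *)

(* A directed graph is a vertex set S together with an edge relation g, of
   which only the edges with both ends in S count. *)
Definition induced (T : finType) (S : {set T}) (g : rel T) : rel T :=
  [rel i j | [&& i \in S, j \in S & g i j]].

Definition source_component (T : finType) (S : {set T}) (g : rel T) : {set T} :=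
  [set i in S | [forall j in S, connect (induced S g) i j]].

Definition contains_source (T : finType) (S : {set T}) (g : rel T) : Prop :=
  source_component S g != finset.set0.

Definition weak_components (T : finType) (g : rel T) : {set {set T}} :=
  equivalence_partition (connect [rel i j | g i j || g j i]) [set: T].

Definition nontrivial_weak_component (T : finType) (g : rel T) (W : {set T}) :
    Prop :=
  W \in weak_components g /\ (1 < #|W|)%N.

(* The edge relation of the reduced graph in which the edges incident to the
   nodes of D are removed; the vertex set remains T. *)
Definition reduced (T : finType) (e : rel T) (D : {set T}) : rel T :=
  [rel i j | [&& e i j, i \notin D & j \notin D]].

(* The nodes of D are isolated in the reduced graph, so that no node has a path
   to all the vertices as soon as D and its complement are nonempty: the
   sources are those of the graph on the remaining nodes. *)
Definition reduced_graphs_contain_source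
    (T : finType) (f : nat) (e : rel T) : Prop :=
  forall F D : {set T}, (#|F| <= f)%N -> D \subset F ->
    contains_source (~: D) (reduced e D).

(* The weakly-connected component has to comprise every node outside D: a node
   outside D that is isolated in the reduced graph would otherwise go
   unnoticed, although it can never agree with the others. *)
Definition reduced_graphs_have_component_with_source
    (T : finType) (f : nat) (e : rel T) : Prop :=
  forall F D : {set T}, (#|F| <= f)%N -> D \subset F ->
    exists W : {set T},
      [/\ unique (nontrivial_weak_component (reduced e D)) W,
          ~: D \subset W
        & contains_source W (reduced e D)].

Local Open Scope classical_set_scope.
Local Open Scope ring_scope.

(** * Iterative algorithms with crash faults *)

(* [crash_time i = Some k]: agent i completes the iterations t < k, crashes
   during iteration k, and takes no part in the later ones (iterations are
   numbered from 1, so k = 0 is a crash before the first iteration).  In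
   iteration k its message reaches only the out-neighbours j such that
   [last_reaches i j]. *)
Record crash_pattern (n : nat) := CrashPattern {
  crash_time : 'I_n -> option nat;
  last_reaches : rel 'I_n }.

(* Agents of F may crash at any time, or never. *)
Definition only_crashes_in (n : nat) (F : {set 'I_n}) (c : crash_pattern n) :
    Prop :=
  forall i, i \notin F -> crash_time c i = None.

Definition completes (n : nat) (c : crash_pattern n) (t : nat) (i : 'I_n) :
    bool :=
  if crash_time c i is Some k then (t < k)%N else true.

Definition delivered (n : nat) (c : crash_pattern n) (t : nat) (i j : 'I_n) :
    bool :=
  completes c t i || ((crash_time c i == Some t) && last_reaches c i j).

(* [Z i x r] is the next state of agent i when its current state is x and
   [r j] is the value received from j; [None] stands for no message. *)
Definition algorithm (R : realType) (n : nat) : Type :=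
  'I_n -> R -> {ffun 'I_n -> option R} -> R.

(* The state of an agent that has crashed is frozen; it is never read. *)
Fixpoint state (R : realType) (n : nat) (e : rel 'I_n) (Z : algorithm R n)
    (c : crash_pattern n) (x0 : 'I_n -> R) (t : nat) : 'I_n -> R :=
  if t is t'.+1 then
    let x := state e Z c x0 t' in
    fun i =>
      if completes c t'.+1 i then
        Z i (x i) [ffun j => if e j i && delivered c t'.+1 j i
                             then Some (x j) else None]
      else x i
  else x0.

Definition convex_hull (R : realType) (T : finType) (y : T -> R) : set R :=
  [set z | exists w : T -> R,
     [/\ forall k, 0 <= w k, \sum_k w k = 1 & z = \sum_k w k * y k]].

Definition crash_consensus_achievable
    (R : realType) (n f : nat) (e : rel 'I_n) : Prop :=
  exists Z : algorithm R n,
    forall (F : {set 'I_n}) (c : crash_pattern n) (x0 : 'I_n -> R),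
      (#|F| <= f)%N -> only_crashes_in F c ->
      (forall t i, i \notin F -> convex_hull x0 (state e Z c x0 t i)) /\
      (forall i j, i \notin F -> j \notin F ->
         (fun t => `|state e Z c x0 t i - state e Z c x0 t j|) @ \oo
           --> (0 : R)).

(* Main.v *)
(* Sufficiency: every agent averages the values it receives, using its own
   value in place of each missing one.  Once all crashes are over, this is a
   fixed averaging dynamics on the reduced graph.  If the states lie in [m, M]
   and the source s has state v, then after N steps every state is at least
   m + n^-N (v - m) and at most M - n^-N (M - v): the spread M - m has been
   multiplied by 1 - n^-N.
   Necessity: without a source, two nonempty sets of agents receive nothing
   from outside; started at 0 and at 1, validity freezes them there. *)
Require Import Defs.
From mathcomp Require Import all_boot all_order all_algebra.
From mathcomp Require Import all_classical all_reals all_analysis.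
From mathcomp Require Import lra.
Import Order.TTheory GRing.Theory Num.Theory.
Import numFieldNormedType.Exports.
(* Undoes the shadowing of [induced] by the charge of that name. *)
Import Defs.

Set Implicit Arguments.
Unset Strict Implicit.
Unset Printing Implicit Defensive.

Local Open Scope ring_scope.

(** * Averaging dynamics on a graph with a source *)

Section Averaging.
Variables (R : realType) (T : finType).

Definition mean (v : T -> R) : R := #|T|%:R^-1 * \sum_j v j.

Lemma meanN (v : T -> R) : mean (fun j => - v j) = - mean v.
Proof. by rewrite /mean sumrN mulrN. Qed.

(** All excesses [v j - m] are nonnegative, so their sum is at least the one at [k], which enters
    the mean with weight [#|T|%:R^-1]. *)
Lemma mean_lower (v : T -> R) (m b : R) (k : T) :
  (forall j, m <= v j) -> b <= v k -> m + #|T|%:R^-1 * (b - m) <= mean v.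
Proof.
move=> mv bv.
have T0 : 0 < #|T|%:R :> R by rewrite ltr0n; apply/card_gt0P; exists k.
rewrite /mean -(ler_pM2l T0) mulrDr !mulrA mulfV ?gt_eqF// !mul1r.
have -> : \sum_j v j = \sum_j (v j - m) + #|T|%:R * m.
  by rewrite sumrB sumr_const mulr_natl subrK.
rewrite addrC lerD2r (bigD1 k)//= -[leLHS]addr0 lerD ?lerB//.
by apply: sumr_ge0 => j _; rewrite subr_ge0.
Qed.

Lemma mean_ge (v : T -> R) (m : R) (k : T) : (forall j, m <= v j) -> m <= mean v.
Proof.
by move=> mv; have := mean_lower mv (mv k); rewrite subrr mulr0 addr0.
Qed.

Variables (S : {set T}) (g : rel T).
Hypothesis g_irr : irreflexive g.

Definition averaging (u : nat -> T -> R) := forall t i, i \in S ->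
  u t.+1 i = mean (fun j => if induced S g j i then u t j else u t i).

(** This symmetry yields each upper bound from the corresponding lower bound. *)
Lemma averagingN (u : nat -> T -> R) :
  averaging u -> averaging (fun t i => - u t i).
Proof.
move=> hu t i iS; rewrite hu// -meanN.
by congr mean; apply/funext => j; case: ifP.
Qed.

Lemma averaging_ge (u : nat -> T -> R) (m : R) (t0 : nat) : averaging u ->
  {in S, forall i, m <= u t0 i} ->
  forall t, {in S, forall i, m <= u (t0 + t)%N i}.
Proof.
move=> hu m0; elim=> [|t IH] i iS; first by rewrite addn0 m0.
rewrite addnS hu//; apply: (mean_ge i) => j.
by case: ifP => [/and3P[jS _ _]|_]; apply: IH.
Qed.

(** In each time step the excess of [s] over [m] either moves along one edge of the path or waits at
    a vertex; both cost one factor [#|T|%:R^-1]. Waiting allows paths shorter than [k]. *)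
Lemma averaging_lower (u : nat -> T -> R) (m : R) (t0 : nat) (s : T) :
  averaging u -> {in S, forall i, m <= u t0 i} -> s \in S ->
  forall k p, path (induced S g) s p -> (size p <= k)%N ->
  m + #|T|%:R^-1 ^+ k * (u t0 s - m) <= u (t0 + k)%N (last s p).
Proof.
move=> hu m0 sS.
have pS p : path (induced S g) s p -> last s p \in S.
  by case/lastP: p => // p z; rewrite rcons_path last_rcons => /andP[_ /and3P[]].
elim=> [|k IH] p gp.
  by rewrite leqn0 size_eq0 => /eqP-> /=; rewrite expr0 mul1r addn0 addrC subrK.
rewrite leq_eqVlt => /orP[|szp].
  (* Full length: the bound crosses the last edge of the path. *)
  case/lastP: p gp => [//|p z] gp; rewrite size_rcons eqSS => /eqP szp.
  have zS := pS _ gp; move: zS gp; rewrite rcons_path last_rcons => zS /andP[gp pz].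
  rewrite addnS hu//.
  have {}IH := IH p gp (eq_leq szp).
  have := @mean_lower (fun j => if induced S g j z then u (t0 + k)%N j
                                else u (t0 + k)%N z) m _ (last s p) _ _.
  rewrite pz => /(_ _ _ IH); rewrite [X in X - m]addrC addrK mulrA -exprS; apply.
  by move=> j; case: ifP => [/and3P[jS _ _]|_]; apply: averaging_ge.
(* Shorter path: the endpoint keeps the bound through its own entry in the mean, since [g] has no
   loop there. *)
have zS := pS _ gp; rewrite addnS hu//.
have := @mean_lower (fun j => if induced S g j (last s p) then u (t0 + k)%N j
                              else u (t0 + k)%N (last s p)) m _ (last s p) _ _.
rewrite {2}/induced /= g_irr !andbF => /(_ _ _ (IH p gp szp)).
rewrite [X in X - m]addrC addrK mulrA -exprS; apply.
by move=> j; case: ifP => [/and3P[jS _ _]|_]; apply: averaging_ge.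
Qed.

Lemma averaging_contracts (u : nat -> T -> R) (s : T) (m M : R) (t0 : nat) :
  averaging u -> s \in S -> {in S, forall i, connect (induced S g) s i} ->
  {in S, forall i, m <= u t0 i <= M} ->
  exists m' M', M' - m' = (1 - #|T|%:R^-1 ^+ #|T|) * (M - m) /\
    {in S, forall i, m' <= u (t0 + #|T|)%N i <= M'}.
Proof.
move=> hu sS src bnd; set d := #|T|%:R^-1 ^+ #|T|.
(* The value of the source cancels in the difference of the two bounds. *)
exists (m + d * (u t0 s - m)), (M - d * (M - u t0 s)); split; first by lra.
move=> i /src /connectP[p gp ->].
(* A simple path has fewer than [#|T|] edges, so [#|T|] steps reach every agent. *)
case/shortenP: gp => {}p gp up _.
have szp : (size p <= #|T|)%N.
  by rewrite ltnW// -[(size p).+1]/(size (s :: p)) -(card_uniqP up) max_card.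
apply/andP; split.
  by apply: averaging_lower => // j /bnd /andP[].
have mN : {in S, forall i, - M <= - u t0 i}.
  by move=> j /bnd /andP[_]; rewrite lerN2.
have := averaging_lower (averagingN hu) mN sS gp szp; rewrite -/d; lra.
Qed.

Lemma averaging_spread (u : nat -> T -> R) (s : T) (t0 : nat) :
  averaging u -> s \in S -> {in S, forall i, connect (induced S g) s i} ->
  exists L : R, forall q, exists m M,
    M - m = (1 - #|T|%:R^-1 ^+ #|T|) ^+ q * L /\
    forall t, (t0 + q * #|T| <= t)%N -> {in S, forall i, m <= u t i <= M}.
Proof.
(* The interval from [- C] to [C] contains all states at time [t0]; its length serves as [L]. *)
move=> hu sS src; pose C := \sum_i `|u t0 i|; exists (C - - C) => q.
suff [m [M [mM bnd]]] : exists m M,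
    M - m = (1 - #|T|%:R^-1 ^+ #|T|) ^+ q * (C - - C) /\
    {in S, forall i, m <= u (t0 + q * #|T|)%N i <= M}.
  (* Averaging never leaves an interval that contains all states of [S]. *)
  exists m, M; split=> // t /subnKC <- i iS; apply/andP; split.
    by apply: averaging_ge => // j /bnd /andP[].
  rewrite -lerN2; apply: (averaging_ge (averagingN hu)) => // j /bnd /andP[_].
  by rewrite lerN2.
elim: q => [|q [m [M [mM bnd]]]].
  exists (- C), C; split; first by rewrite expr0 mul1r.
  move=> i _; rewrite -ler_norml mul0n addn0 /C (bigD1 i)//= lerDl.
  exact: sumr_ge0.
have [m' [M' [mM' bnd']]] := averaging_contracts hu sS src bnd.
exists m', M'; split; first by rewrite mM' mM mulrA -exprS.
by rewrite mulSn [(#|T| + _)%N]addnC addnA.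
Qed.

(** The spread decays geometrically. The shift by [t0] discards the iterations in which crashes
    still occur. *)
Lemma averaging_consensus (u : nat -> T -> R) (s : T) (t0 : nat) :
  averaging (fun t => u (t0 + t)%N) -> s \in S ->
  {in S, forall i, connect (induced S g) s i} ->
  {in S &, forall i j, ((fun t => `|u t i - u t j|) @ \oo --> (0 : R))%classic}.
Proof.
move=> hu sS src i j iS jS.
have [L HL] := averaging_spread 0 hu sS src.
set d := #|T|%:R^-1 ^+ #|T| in HL.
have T0 : (0 < #|T|)%N by apply/card_gt0P; exists s.
have d0 : 0 < d by rewrite exprn_gt0// invr_gt0 ltr0n.
(* Equality occurs for a single agent; in all cases [1 - d] lies in [0, 1). *)
have d1 : d <= 1.
  by rewrite exprn_ile1 ?invr_ge0// invf_le1 ?ltr0n// ler1n.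
have cv : ((fun q => (1 - d) ^+ q * L) @ \oo --> (0 : R))%classic.
  rewrite -[X in (_ --> X)%classic](mul0r L); apply: cvgMl.
  by apply: cvg_expr; rewrite ger0_norm; lra.
apply/cvgrPdist_lt => eps eps0.
have /cvgrPdist_lt /(_ _ eps0) [q _ /(_ q (leqnn q))] := cv.
rewrite /= sub0r normrN => dq.
have [m [M [mM bnd]]] := HL q.
exists (t0 + q * #|T|)%N => // t /= tq.
rewrite sub0r normrN normr_id.
have t0t : (t0 <= t)%N by apply: leq_trans tq; apply: leq_addr.
have bt : {in S, forall k, m <= u t k <= M}.
  by rewrite -(subnKC t0t); apply: bnd; rewrite add0n leq_subRL.
have /andP[? ?] := bt _ iS; have /andP[? ?] := bt _ jS.
apply: le_lt_trans dq; apply: le_trans (ler_norm _).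
by rewrite -mM ler_norml; apply/andP; split; lra.
Qed.

End Averaging.

(** * Convex hulls of the initial states *)

Section ConvexHull.
Variables (R : realType) (T : finType) (y : T -> R).

Lemma convex_hull_point (k : T) : convex_hull y (y k).
Proof.
exists (fun j => (j == k)%:R); split => [j||]; first exact: ler0n.
- by rewrite (bigD1 k)//= eqxx big1 ?addr0// => j /negPf->.
- by rewrite (bigD1 k)//= eqxx mul1r big1 ?addr0// => j /negPf->; rewrite mul0r.
Qed.

Lemma convex_hull_mean (U : finType) (v : U -> R) : (0 < #|U|)%N ->
  (forall j, convex_hull y (v j)) -> convex_hull y (mean v).
Proof.
move=> U0 /choice[w Hw]; exists (fun k => mean (w^~ k)); split.
- move=> k; apply: mulr_ge0; first by rewrite invr_ge0.
  by apply: sumr_ge0 => j _; have [w0 _ _] := Hw j; exact: w0.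
- rewrite /mean -mulr_sumr exchange_big/=.
  under eq_bigr => j _ do have [_ -> _] := Hw j.
  by rewrite sumr_const mulVf// pnatr_eq0 -lt0n.
- rewrite /mean; under [RHS]eq_bigr do rewrite -mulrA mulr_suml.
  rewrite -mulr_sumr exchange_big/=; congr (_ * _).
  by apply: eq_bigr => j _; have [_ _ ->] := Hw j.
Qed.

End ConvexHull.

(** Equal initial states leave validity no freedom, which is what the necessity proof exploits. *)
Lemma convex_hull_cst (R : realType) (T : finType) (a z : R) :
  convex_hull (fun _ : T => a) z -> z = a.
Proof. by move=> [w [_ w1 ->]]; rewrite -mulr_suml w1 mul1r. Qed.

(** * Sufficiency: averaging under crash faults *)

Definition averaging_algorithm (R : realType) (n : nat) : algorithm R n :=
  fun i x r => mean (fun j => odflt x (r j)).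

Section Sufficiency.
Variables (R : realType) (n : nat) (e : rel 'I_n) (c : crash_pattern n).
Variable x0 : 'I_n -> R.

Local Notation x := (state e (@averaging_algorithm R n) c x0).

Lemma averaging_stateS t i : x t.+1 i =
  if completes c t.+1 i then
    mean (fun j => if e j i && delivered c t.+1 j i then x t j else x t i)
  else x t i.
Proof.
rewrite /=; case: ifP => // _; congr mean; apply/funext => j.
by rewrite ffunE; case: ifP.
Qed.

Lemma averaging_state_hull t i : convex_hull x0 (x t i).
Proof.
elim: t i => [|t IH] i; first exact: convex_hull_point.
rewrite averaging_stateS; case: ifP => // _.
apply: convex_hull_mean => [|j]; last by case: ifP.
by apply/card_gt0P; exists i.
Qed.

(** This is the set removed from the graph; it may be smaller than the fault set, whose agents need
    not crash. *)
Definition crashed : {set 'I_n} := [set i | crash_time c i != None].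

Lemma crashes_end :
  exists t0, forall t i j, (t0 < t)%N -> delivered c t i j = (i \notin crashed).
Proof.
(* The default 0 keeps agents that never crash from affecting the maximum. The strict [t0 < t]
   excludes the partial deliveries of a crash iteration. *)
exists (\max_i odflt 0%N (crash_time c i)) => t i j tlt.
rewrite /delivered /completes inE negbK.
case E : (crash_time c i) => [k|]; rewrite ?eqxx//.
have kt : (k < t)%N.
  apply: leq_ltn_trans tlt.
  by have := leq_bigmax (F := fun i => odflt 0%N (crash_time c i)) i; rewrite E.
have -> : (Some k == Some t) = false by apply/eqP => -[kE]; rewrite kE ltnn in kt.
by rewrite ltnNge ltnW.
Qed.

Lemma averaging_state_eventually : exists t0,
  averaging (~: crashed) (reduced e crashed) (fun t => x (t0 + t)%N).
Proof.
have [t0 end_] := crashes_end; exists t0 => t i; rewrite finset.in_setC => iS.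
rewrite addnS averaging_stateS.
have -> : completes c (t0 + t).+1 i.
  by move: iS; rewrite inE negbK /completes => /eqP->.
congr mean; apply/funext => j.
(* The iteration leaving state [t0 + t] has number [(t0 + t).+1], which is past all crashes. *)
rewrite end_ ?ltnS ?leq_addr// /induced /reduced /= !finset.in_setC iS andbT.
by case: (j \in crashed); rewrite ?andbF ?andbT.
Qed.

End Sufficiency.

Lemma source_consensus (R : realType) (n f : nat) (e : rel 'I_n) :
  irreflexive e -> reduced_graphs_contain_source f e ->
  crash_consensus_achievable R f e.
Proof.
move=> e_irr src; exists (@averaging_algorithm R n) => F c x0 Ff cF.
split=> [t i _|i j iF jF]; first exact: averaging_state_hull.
have DF : crashed c \subset F.
  by apply/fintype.subsetP => k; rewrite inE; apply: contraR => /cF->.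
have /set0Pn[s] := src F (crashed c) Ff DF.
rewrite inE => /andP[sS /forall_inP sP].
have [t0 avg] := averaging_state_eventually e c x0.
have inS k : k \notin F -> k \in ~: crashed c.
  by rewrite finset.in_setC; apply: contra => /(fintype.subsetP DF).
apply: (averaging_consensus _ avg sS sP (inS _ iF) (inS _ jF)).
by move=> k; rewrite /reduced/= e_irr.
Qed.

(** * Necessity: isolated groups of agents *)

Lemma state_local (R : realType) (n : nat) (e : rel 'I_n) (Z : algorithm R n)
    (c : crash_pattern n) (x0 y0 : 'I_n -> R) (A : {set 'I_n}) :
  (forall t i j, i \in A -> e j i -> delivered c t.+1 j i -> j \in A) ->
  {in A, x0 =1 y0} ->
  forall t, {in A, state e Z c x0 t =1 state e Z c y0 t}.
Proof.
move=> closed xy; elim=> [|t IH] i iA /=; first exact: xy.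
rewrite !(IH i iA); case: ifP => // _; congr (Z _ _ _); apply/ffunP => j.
rewrite !ffunE; case: ifP => // /andP[eji dji].
by rewrite (IH j (closed _ _ _ iA eji dji)).
Qed.

(** Agents of [A] cannot tell [x0] from the run in which everybody starts at [a], where validity
    permits only the state [a]. *)
Lemma consensus_frozen (R : realType) (n : nat) (e : rel 'I_n)
    (Z : algorithm R n) (c : crash_pattern n) (F : {set 'I_n})
    (x0 : 'I_n -> R) (A : {set 'I_n}) (a : R) :
  (forall t i j, i \in A -> e j i -> delivered c t.+1 j i -> j \in A) ->
  (forall y0 t i, i \notin F -> convex_hull y0 (state e Z c y0 t i)) ->
  {in A, forall i, x0 i = a} ->
  forall t i, i \in A -> i \notin F -> state e Z c x0 t i = a.
Proof.
move=> closed hull xa t i iA iF.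
rewrite (@state_local _ _ _ _ _ x0 (fun=> a) A)//.
exact: (convex_hull_cst (hull _ _ _ iF)).
Qed.

(** Take [v] with the fewest ancestors and [w] not reachable from [v]. By minimality every ancestor
    [z] of [v] has the same ancestors as [v], so [v] reaches [z]; if [z] reached [w], so would
    [v]. *)
Lemma no_source_disjoint_ancestors (T : finType) (S : {set T}) (g : rel T) :
  S != finset.set0 -> ~ contains_source S g ->
  exists v w, [/\ v \in S, w \in S & forall z, z \in S ->
    connect (induced S g) z v -> connect (induced S g) z w -> False].
Proof.
move=> /set0Pn[v0 v0S] nosrc; set r := induced S g.
pose anc v := [set u in S | connect r u v].
case: (arg_minnP (P := [in S]) (fun v => #|anc v|) v0S) => v /= vS vmin.
have [w wS vw] : exists2 w, w \in S & ~~ connect r v w.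
  apply/exists_inP; rewrite -negb_forall_in; apply/negP => vsrc.
  by apply: nosrc; apply/set0Pn; exists v; rewrite inE; apply/andP.
exists v, w; split=> // z zS zv zw.
have sub : anc z \subset anc v.
  apply/fintype.subsetP => u; rewrite !inE => /andP[-> uz].
  exact: connect_trans uz zv.
have /eqP ancE : anc z == anc v by rewrite eqEcard sub vmin.
have : v \in anc z by rewrite ancE inE vS connect0.
by rewrite inE => /andP[_ vz]; rewrite (connect_trans vz zw) in vw.
Qed.

Lemma consensus_source (R : realType) (n f : nat) (e : rel 'I_n) :
  (f < n)%N -> crash_consensus_achievable R f e ->
  reduced_graphs_contain_source f e.
Proof.
move=> fn [Z HZ] F D Ff DF; apply: contrapT => nosrc.
have Df : (#|D| <= f)%N := leq_trans (subset_leq_card DF) Ff.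
have D0 : ~: D != finset.set0.
  by rewrite -card_gt0 cardsCs finset.setCK card_ord subn_gt0 (leq_ltn_trans Df).
have [v [w [vS wS disj]]] := no_source_disjoint_ancestors D0 nosrc.
set r := induced _ _ in disj.
(* Deliveries start with iteration 1, so a crash at 0 silences [D] entirely and messages flow
   exactly along the reduced graph. *)
pose c := CrashPattern (fun i => if i \in D then Some 0%N else None)
  (fun _ _ : 'I_n => false).
(* With [D] instead of [F] as fault set, validity and agreement cover every agent outside [D], in
   particular [v] and [w]. *)
have cD : only_crashes_in D c by move=> i /negPf /= ->.
pose anc u := [set z in ~: D | connect r z u].
have closed u t i j :
    i \in anc u -> e j i -> delivered c t.+1 j i -> j \in anc u.
  rewrite /delivered /completes /= !inE andbF orbF => /andP[iD iu] eji.
  case: ifP => // /negbT jD _ /=; apply: connect_trans iu; apply: connect1.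
  by rewrite /r /induced /reduced /= !finset.in_setC jD iD eji.
have hull y0 t i : i \notin D -> convex_hull y0 (state e Z c y0 t i).
  by have [+ _] := HZ D c y0 Df cD; apply.
(* Disjointness of the ancestor sets makes this 0 on all of [anc v]. *)
pose x0 i : R := if i \in anc w then 1 else 0.
have [vD wD] : v \notin D /\ w \notin D by rewrite -!finset.in_setC.
have xv t : state e Z c x0 t v = 0.
  apply: (@consensus_frozen _ _ _ _ _ D _ (anc v)) => //; first exact: closed.
    move=> i; rewrite /x0 !inE => /andP[iD iv]; case: ifP => // /andP[_ iw].
    by case: (disj i); rewrite ?inE.
  by rewrite inE vS connect0.
have xw t : state e Z c x0 t w = 1.
  apply: (@consensus_frozen _ _ _ _ _ D _ (anc w)) => //; first exact: closed.
    by move=> i iw; rewrite /x0 iw.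
  by rewrite inE wS connect0.
have [_ /(_ v w vD wD)] := HZ D c x0 Df cD.
under eq_fun do rewrite xv xw sub0r normrN normr1.
move=> /cvgrPdist_lt /(_ 1 ltr01) [N _ /(_ N (leqnn N))] /=.
by rewrite sub0r normrN normr1 ltxx.
Qed.

(** * Sources and weakly-connected components *)

Section WeakComponents.
Variables (T : finType) (e : rel T) (D : {set T}).

Let sym : rel T := [rel i j | reduced e D i j || reduced e D j i].

Let sym_connect : connect_sym sym.
Proof. by apply: sym_connect_sym => i j; rewrite /sym /= orbC. Qed.

Lemma weak_componentP (W : {set T}) :
  reflect (exists x, W = [set y | connect sym x y])
          (W \in weak_components (reduced e D)).
Proof.
apply: (iffP imsetP) => [[x _ ->]|[x ->]]; exists x; rewrite ?finset.in_setT//;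
  by apply/setP => y; rewrite !inE.
Qed.

Lemma removed_isolated (x y : T) : x \in D -> connect sym x y -> y = x.
Proof.
move=> xD /connectP[[|z p] /= + -> //].
by rewrite /sym /reduced /= xD /= !andbF.
Qed.

(** A removed node is isolated, so a component containing one is a singleton. *)
Lemma nontrivial_weak_component_sub (W : {set T}) :
  nontrivial_weak_component (reduced e D) W -> W \subset ~: D.
Proof.
move=> [/weak_componentP[x ->]] /card_gt1P[a [b [+ + ab]]].
rewrite !inE => xa xb; apply/fintype.subsetP => y; rewrite !inE => xy.
apply/negP => yD; have yx : connect sym y x by rewrite sym_connect.
have yE z : connect sym x z -> z = y.
  by move=> xz; apply: removed_isolated => //; apply: connect_trans yx xz.
by rewrite (yE a)// (yE b)// eqxx in ab.
Qed.

(** Directed paths from a source already join all of [~: D] weakly, and any other nontrivial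
    component would also lie in [~: D], hence meet this one. *)
Lemma source_component_unique : (1 < #|~: D|)%N ->
  contains_source (~: D) (reduced e D) ->
  unique (nontrivial_weak_component (reduced e D)) (~: D).
Proof.
move=> D1 /set0Pn[s]; rewrite inE => /andP[sD /forall_inP sP].
pose W := [set y | connect sym s y].
have ss y : y \in ~: D -> connect sym s y.
  move=> /sP; apply: connect_sub => i j /and3P[_ _ ij].
  by apply: connect1; rewrite /sym /= ij.
have DW : ~: D \subset W by apply/fintype.subsetP => y /ss; rewrite inE.
have Wcomp : nontrivial_weak_component (reduced e D) W.
  split; first by apply/weak_componentP; exists s.
  exact: leq_trans D1 (subset_leq_card DW).
have -> : ~: D = W.
  by apply/eqP; rewrite finset.eqEsubset DW nontrivial_weak_component_sub.
split=> // W' W'comp; have W'D := nontrivial_weak_component_sub W'comp.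
have [/weak_componentP[x W'E] _] := W'comp.
have /ss sx : x \in ~: D by apply: (fintype.subsetP W'D); rewrite W'E inE connect0.
by rewrite W'E; apply/setP => y; rewrite !inE; apply: same_connect.
Qed.

End WeakComponents.

(** The bound on [n] leaves at least two nodes outside [D], so [~: D] can be a nontrivial component;
    conversely, a nontrivial component containing [~: D] equals it. *)
Lemma source_component_equiv (n f : nat) (e : rel 'I_n) : (f.+1 < n)%N ->
  reduced_graphs_contain_source f e <->
  reduced_graphs_have_component_with_source f e.
Proof.
move=> fn; split=> src F D Ff DF.
  have srcD := src F D Ff DF; exists (~: D); split=> //.
  apply: source_component_unique => //.
  rewrite cardsCs finset.setCK card_ord ltn_subRL addn1.
  by rewrite (leq_ltn_trans _ fn)// ltnS (leq_trans (subset_leq_card DF)).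
have [W [[Wcomp _] DW srcW]] := src F D Ff DF.
suff -> : ~: D = W by [].
by apply/eqP; rewrite finset.eqEsubset DW (nontrivial_weak_component_sub Wcomp).
Qed.

Theorem theorem5 (R : realType) (n f : nat) (e : rel 'I_n)
    (e_irr : irreflexive e) (f_lt_n : (f < n)%N) :
  (crash_consensus_achievable R f e <-> reduced_graphs_contain_source f e) /\
  ((f.+1 < n)%N ->
   (crash_consensus_achievable R f e <->
    reduced_graphs_have_component_with_source f e)).
Proof.
have main : crash_consensus_achievable R f e <-> reduced_graphs_contain_source f e.
  by split; [exact: consensus_source | exact: source_consensus].
by split=> // fn; rewrite main; exact: source_component_equiv.
Qed.
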